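(* $\mathcal{T}\le_s\mathrm{NonLow}$. That is, there is a Turing functional $\Theta$ such that for every $Z\subseteq\omega$ with $Z'\not\le_{\mathrm T}\emptyset'$, $\Theta^Z$ is (the characteristic function of) a set encoding a maximal tower of computable sets.
   Context: For sets $A,B\subseteq\omega$, $A\subseteq^* B$ means $A\setminus B$ is finite. With $\langle\cdot,\cdot\rangle$ the usual computable Cantor pairing function on $\omega$, a set $X\subseteq\omega$ encodes the sequence $(X_n)_{n\in\omega}$ of its columns $X_n=\{u:\langle u,n\rangle\in X\}$. A set $G$ is a tower of computable sets if each $G_n$ is computable, $G_0=\omega$, and for each $n$, $G_{n+1}\subseteq^* G_n$ and $G_n\setminus G_{n+1}$ is infinite. It is maximal if for each infinite computable set $R$ there is $n$ such that $R\setminus G_n$ is infinite. $\mathcal{T}$ is the class of sets encoding maximal towers of computable sets. $Z'$ denotes the Turing jump of $Z$. $\mathrm{NonLow}$ is the class of sets $Z\subseteq\omega$ with $Z'\not\le_{\mathrm T}\emptyset'$. Medvedev reducibility between classes of functions on $\omega$ (sets are identified with characteristic functions): $\mathcal{C}\le_s\mathcal{D}$ if there is a Turing functional $\Theta$ such that $\Theta^g\in\mathcal{C}$ for each $g\in\mathcal{D}$. *)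

(* Defs.v *)
From Stdlib Require Cantor.
From mathcomp Require Import all_boot.
From mathcomp Require Import boolp classical_sets functions cardinality.

Set Implicit Arguments.
Unset Strict Implicit.
Unset Printing Implicit Defensive.

Local Open Scope classical_set_scope.

(* [Stdlib.Arith.Cantor.to_nat (x, y) = (x + y)(x + y + 1)/2 + y]. *)
Definition pairing (x y : nat) : nat := Cantor.to_nat (x, y).
Definition unpair1 (p : nat) : nat := (Cantor.of_nat p).1.
Definition unpair2 (p : nat) : nat := (Cantor.of_nat p).2.

(* Programs for the unary partial functions on nat that are recursive in an
   oracle g : nat -> nat. Functions of several arguments are coded by pairing,
   so that the projections and pairing are among the initial operations. *)
Inductive prog : Set :=
  | Zero | Succ | Fst | Snd
  | Query
  | Pair of prog & prog
  | Comp of prog & prog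
  | PRec of prog & prog
  | Mu of prog.

(* [eval g c x y]: with oracle g, program c halts on input x with output y.
   [PRec b s] is primitive recursion: it maps <a, 0> to b(a) and <a, n + 1> to
   s(<a, <n, z>>), where z is its value at <a, n>.
   [Mu f] maps a to the least k such that f(<a, k>) = 0, provided that
   f(<a, j>) is defined for all j < k. *)
Fixpoint eval (g : nat -> nat) (c : prog) : nat -> nat -> Prop :=
  match c with
  | Zero => fun x y => y = 0
  | Succ => fun x y => y = x.+1
  | Fst => fun x y => y = unpair1 x
  | Snd => fun x y => y = unpair2 x
  | Query => fun x y => y = g x
  | Pair c1 c2 => fun x y =>
      exists y1 y2, [/\ eval g c1 x y1, eval g c2 x y2 & y = pairing y1 y2]
  | Comp c1 c2 => fun x y => exists2 z, eval g c2 x z & eval g c1 z y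
  | PRec b s => fun x y =>
      (fix iter_rec (a n y : nat) {struct n} : Prop :=
         if n is n'.+1 then
           exists2 z, iter_rec a n' z & eval g s (pairing a (pairing n' z)) y
         else eval g b a y) (unpair1 x) (unpair2 x) y
  | Mu f => fun a k =>
      eval g f (pairing a k) 0 /\
      forall j, j < k -> exists v, eval g f (pairing a j) v.+1
  end.

Lemma eval_det g c x y y' : eval g c x y -> eval g c x y' -> y = y'.
Proof.
elim: c x y y' => /= [|||||c1 IH1 c2 IH2|c1 IH1 c2 IH2|b IHb s IHs|f IHf].
1-5: by move=> x y y' -> ->.
- move=> x y y' [u [v [Hu Hv ->]]] [u' [v' [Hu' Hv' ->]]].
  by rewrite (IH1 _ _ _ Hu Hu') (IH2 _ _ _ Hv Hv').
- move=> x y y' [z Hz Hy] [z' Hz' Hy'].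
  by move: Hy'; rewrite -(IH2 _ _ _ Hz Hz'); apply: IH1 Hy.
- move=> x; elim: (unpair2 x) => [|n IHn] y y'; first exact: IHb.
  move=> [z Hz Hy] [z' Hz' Hy'].
  by move: Hy'; rewrite -(IHn _ _ Hz Hz'); apply: IHs Hy.
- move=> a k k' [Hk Lk] [Hk' Lk']; case: (ltngtP k k') => // lt.
  + by have [v Hv] := Lk' _ lt; have := IHf _ _ _ Hk Hv.
  + by have [v Hv] := Lk _ lt; have := IHf _ _ _ Hk' Hv.
Qed.

Fixpoint oracle_free (c : prog) : bool :=
  match c with
  | Query => false
  | Pair c1 c2 | Comp c1 c2 | PRec c1 c2 => oracle_free c1 && oracle_free c2
  | Mu f => oracle_free f
  | _ => true
  end.

Fixpoint godel (c : prog) : nat :=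
  match c with
  | Zero => pairing 0 0
  | Succ => pairing 1 0
  | Fst => pairing 2 0
  | Snd => pairing 3 0
  | Query => pairing 4 0
  | Pair c1 c2 => pairing 5 (pairing (godel c1) (godel c2))
  | Comp c1 c2 => pairing 6 (pairing (godel c1) (godel c2))
  | PRec c1 c2 => pairing 7 (pairing (godel c1) (godel c2))
  | Mu f => pairing 8 (godel f)
  end.

Lemma pairing_inj x y x' y' : pairing x y = pairing x' y' -> x = x' /\ y = y'.
Proof. by move=> /Cantor.to_nat_inj[-> ->]. Qed.

Lemma godel_inj : injective godel.
Proof.
elim=> [|||||c IHc d IHd|c IHc d IHd|c IHc d IHd|c IHc]
  [|||||c' d'|c' d'|c' d'|c'] //= /pairing_inj[] // _.
1-3: by move=> /pairing_inj[/IHc -> /IHd ->].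
by move=> /IHc ->.
Qed.

(* The characteristic function, with values 0 and 1. *)
Definition chi (X : set nat) : nat -> nat := fun n => n \in X.

Definition computable (X : set nat) : Prop :=
  exists2 c, oracle_free c & forall g n, eval g c n (chi X n).

Definition turing_le (X Y : set nat) : Prop :=
  exists c, forall n, eval (chi Y) c n (chi X n).

(* A number that is not the code of a program is an index of the nowhere
   defined functional, hence is not in the jump. *)
Definition jump (Z : set nat) : set nat :=
  [set e | exists2 c, godel c = e & exists y, eval (chi Z) c e y].

Definition NonLow : set (set nat) :=
  [set Z | ~ turing_le (jump Z) (jump set0)].

Definition almost_subset (A B : set nat) : Prop := finite_set (A `\` B).

Definition column (X : set nat) (n : nat) : set nat :=
  [set u | X (pairing u n)].

Definition computable_tower (G : set nat) : Prop :=
  [/\ forall n, computable (column G n),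
      column G 0 = setT
    & forall n, almost_subset (column G n.+1) (column G n) /\
                infinite_set (column G n `\` column G n.+1)].

Definition maximal_tower (G : set nat) : Prop :=
  computable_tower G /\
  forall R, computable R -> infinite_set R ->
    exists n, infinite_set (R `\` column G n).

Definition MaxTowers : set (set nat) := [set G | maximal_tower G].

(* The Turing functional is given by the program c; that it maps g to an
   element h of C includes that it is total on the oracle g. *)
Definition medvedev_le (C D : set (nat -> nat)) : Prop :=
  exists c, forall g, D g -> exists2 h, C h & forall n, eval g c n (h n).

(* Main.v *)
Require Import Defs.
From Stdlib Require Cantor.
From mathcomp Require Import all_boot.
From mathcomp Require Import boolp classical_sets functions cardinality.

(** Read each number x as a sequence of numbers, with entries [coord i x], by
    unpairing it again and again, and let the n-th column of the tower be the set
    of those x with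

      coord i x = Z'_x(i)   for all i < n,

    where Z'_x is stage x of an enumeration of the jump of Z relative to Z. A
    single program with oracle Z decides membership in all columns. Since Z'_x(i)
    is eventually equal to Z'(i), the n-th column agrees up to finitely many
    numbers with the set of x that begin with the first n values of Z'. This set
    is computable, though not uniformly in n: its program contains those values.
    As entry n is arbitrary in it, passing to the next column loses infinitely many
    numbers ([computable_tower_tower]).

    If an infinite computable set R is almost contained in every column, then
    Z'(i) is the limit of [coord i x] as x runs through R, for each i. So Z' is
    computable in the halting problem by the limit lemma [limit_turing_le], and Z
    is low. For nonlow Z the tower is therefore maximal ([maximal_tower_tower]).

    The approximation Z'_x requires a universal machine. Programs are run by a
    stack machine whose stack holds the pending tasks ([step]); its steps are
    primitive recursive on codes of states ([eff_code_step]), a program halts if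
    and only if its run empties the stack ([halts_reaches]), and it is decidable
    which numbers are codes of programs ([is_codeP]), so Z'_x(i) is obtained by
    running the program with code i on input i for x steps ([jump_stage]). *)

Set Implicit Arguments.
Unset Strict Implicit.
Unset Printing Implicit Defensive.

Local Open Scope classical_set_scope.

Arguments pairing : simpl never.
Arguments unpair1 : simpl never.
Arguments unpair2 : simpl never.

(** * Pairing *)

Lemma pairingK1 x y : unpair1 (pairing x y) = x.
Proof. by rewrite /unpair1 /pairing Cantor.cancel_of_to. Qed.

Lemma pairingK2 x y : unpair2 (pairing x y) = y.
Proof. by rewrite /unpair2 /pairing Cantor.cancel_of_to. Qed.

Definition pairingK := (pairingK1, pairingK2).

Lemma unpairK p : pairing (unpair1 p) (unpair2 p) = p.
Proof.
by rewrite /pairing /unpair1 /unpair2 -surjective_pairing Cantor.cancel_to_of.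
Qed.

Lemma leq_add_pairing x y : x + y <= pairing x y.
Proof. by rewrite addnC; apply/leP; apply: Cantor.to_nat_non_decreasing. Qed.

Lemma leq_pairing1 x y : x <= pairing x y.
Proof. exact: leq_trans (leq_addr _ _) (leq_add_pairing x y). Qed.

Lemma leq_pairing2 x y : y <= pairing x y.
Proof. exact: leq_trans (leq_addl _ _) (leq_add_pairing x y). Qed.

Lemma ltn_pairing2 x y : 0 < x -> y < pairing x y.
Proof.
by move=> x_gt0; apply: leq_trans (leq_add_pairing x y); rewrite -add1n leq_add2r.
Qed.

(** * Total functionals computed by programs *)

(** One program must serve all oracles: this uniformity turns a
    construction relative to Z into a single Turing functional. *)
Definition effective (F : (nat -> nat) -> nat -> nat) :=
  exists c, forall g x, eval g c x (F g x).

Lemma eff_ext F F' : (forall g x, F g x = F' g x) -> effective F -> effective F'.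
Proof. by move=> eqF [c hc]; exists c => g x; rewrite -eqF. Qed.

Lemma eff_arg : effective (fun g x => x).
Proof. by exists (Pair Fst Snd) => g x; exists (unpair1 x), (unpair2 x); rewrite unpairK. Qed.

Lemma eff_comp F G : effective F -> effective G -> effective (fun g x => F g (G g x)).
Proof. by case=> c hc [d hd]; exists (Comp c d) => g x; exists (G g x). Qed.

Lemma eff_succ F : effective F -> effective (fun g x => (F g x).+1).
Proof. by apply: (@eff_comp (fun g x => x.+1)); exists Succ. Qed.

Lemma eff_fst F : effective F -> effective (fun g x => unpair1 (F g x)).
Proof. by apply: (@eff_comp (fun g x => unpair1 x)); exists Fst. Qed.

Lemma eff_snd F : effective F -> effective (fun g x => unpair2 (F g x)).
Proof. by apply: (@eff_comp (fun g x => unpair2 x)); exists Snd. Qed.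

Lemma eff_query F : effective F -> effective (fun g x => g (F g x)).
Proof. by apply: (@eff_comp (fun g x => g x)); exists Query. Qed.

Lemma eff_pair F G : effective F -> effective G ->
  effective (fun g x => pairing (F g x) (G g x)).
Proof.
by case=> c hc [d hd]; exists (Pair c d) => g x; exists (F g x), (G g x).
Qed.

Lemma eff_const n : effective (fun g x => n).
Proof. by elim: n => [|n IHn]; [exists Zero | apply: eff_succ]. Qed.

Lemma eff_bin (h : (nat -> nat) -> nat -> nat -> nat) F G :
    effective (fun g p => h g (unpair1 p) (unpair2 p)) ->
  effective F -> effective G -> effective (fun g x => h g (F g x) (G g x)).
Proof.
move=> hh hF hG; have := eff_comp hh (eff_pair hF hG).
by apply: eff_ext => g x; rewrite !pairingK.
Qed.

(** Primitive recursion, in the form in which it is used: a functional that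
    satisfies recursion equations is recognized as effective. *)
Lemma eff_rec (h : (nat -> nat) -> nat -> nat -> nat) b s F G :
    effective b ->
    effective (fun g p => s g (unpair1 p) (unpair1 (unpair2 p)) (unpair2 (unpair2 p))) ->
    (forall g x, h g x 0 = b g x) ->
    (forall g x n, h g x n.+1 = s g x n (h g x n)) ->
  effective F -> effective G -> effective (fun g x => h g (F g x) (G g x)).
Proof.
move=> [cb hb] [cs hs] h0 hS; apply: eff_bin; exists (PRec cb cs) => g p /=.
elim: (unpair2 p) => [|n IHn]; first by rewrite h0.
exists (h g (unpair1 p) n) => //; rewrite hS.
by have := hs g (pairing (unpair1 p) (pairing n (h g (unpair1 p) n))); rewrite !pairingK.
Qed.

Ltac effective := repeat first
  [ assumption | apply: eff_arg | apply: eff_const | apply: eff_pair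
  | apply: eff_fst | apply: eff_snd | apply: eff_succ | apply: eff_query ].

Lemma eff_if (c : (nat -> nat) -> nat -> bool) F G :
    effective (fun g x => c g x) -> effective F -> effective G ->
  effective (fun g x => if c g x then F g x else G g x).
Proof.
move=> hc hF hG.
pose h g x n := if n is n'.+1 then F g x else G g x.
have : effective (fun g x => h g x (c g x)).
  apply: (@eff_rec h G (fun g x _ _ => F g x)) => //; effective.
  by apply: (eff_comp hF); effective.
by apply: eff_ext => g x; case: (c g x).
Qed.

Lemma eff_ifb (c a b : (nat -> nat) -> nat -> bool) :
    effective (fun g x => c g x) -> effective (fun g x => a g x) ->
    effective (fun g x => b g x) ->
  effective (fun g x => if c g x then a g x else b g x).
Proof.
by move=> hc ha hb; apply: eff_ext (eff_if hc ha hb) => g x; case: (c g x).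
Qed.

Lemma eff_pred F : effective F -> effective (fun g x => (F g x).-1).
Proof.
move=> hF; apply: (@eff_rec (fun g _ n => n.-1) (fun _ _ => 0) (fun _ _ n _ => n)) => //;
  effective.
Qed.

Lemma eff_sub F G : effective F -> effective G -> effective (fun g x => F g x - G g x).
Proof.
move=> hF hG.
apply: (@eff_rec (fun g x n => x - n) (fun _ x => x) (fun _ _ _ z => z.-1)) => //;
  try by move=> *; rewrite ?subn0 ?subnS.
- exact: eff_arg.
- by apply: eff_pred; effective.
Qed.

Lemma eff_and (b c : (nat -> nat) -> nat -> bool) :
    effective (fun g x => b g x) -> effective (fun g x => c g x) ->
  effective (fun g x => b g x && c g x).
Proof.
move=> hb hc; have := eff_if hb hc (eff_const 0).
by apply: eff_ext => g x; case: (b g x).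
Qed.

Lemma eff_not (b : (nat -> nat) -> nat -> bool) :
  effective (fun g x => b g x) -> effective (fun g x => ~~ b g x).
Proof.
move=> hb; have := eff_if hb (eff_const 0) (eff_const 1).
by apply: eff_ext => g x; case: (b g x).
Qed.

Lemma eff_leq F G : effective F -> effective G -> effective (fun g x => F g x <= G g x).
Proof.
move=> hF hG; have := eff_sub (eff_const 1) (eff_sub hF hG).
by apply: eff_ext => g x; rewrite /leq; case: (F g x - G g x).
Qed.

Lemma eff_eq F G : effective F -> effective G -> effective (fun g x => F g x == G g x).
Proof.
move=> hF hG; have := eff_and (eff_leq hF hG) (eff_leq hG hF).
by apply: eff_ext => g x; rewrite -eqn_leq.
Qed.

Lemma eff_iter (h : (nat -> nat) -> nat -> nat) N F :
    effective (fun g x => h g x) -> effective N -> effective F ->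
  effective (fun g x => iter (N g x) (h g) (F g x)).
Proof.
move=> hh hN hF.
apply: (@eff_rec (fun g x n => iter n (h g) x) (fun _ x => x) (fun g _ _ z => h g z)) => //;
  first exact: eff_arg.
by apply: (eff_comp hh); effective.
Qed.

(** The sequence that a number codes under iterated unpairing, as each number is
    <a_0, <a_1, <... >>>. It is used for tables, and for the tower: finitely
    many entries can be prescribed, leaving infinitely many numbers. *)
Definition coord i x := unpair1 (iter i unpair2 x).

Lemma coord0 x : coord 0 x = unpair1 x. Proof. by []. Qed.

Lemma coordS i x : coord i.+1 x = coord i (unpair2 x).
Proof. by rewrite /coord iterSr. Qed.

Lemma eff_coord I F : effective I -> effective F ->
  effective (fun g x => coord (I g x) (F g x)).
Proof.
move=> hI hF; apply: eff_fst; apply: (@eff_iter (fun _ => unpair2)) => //.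
by apply: eff_snd; apply: eff_arg.
Qed.

(* The rule for [coord] comes first, since the others would see through its
   definition. *)
Ltac effective ::= repeat first
  [ assumption | apply: eff_coord | apply: eff_arg | apply: eff_const
  | apply: eff_pair | apply: eff_fst | apply: eff_snd | apply: eff_succ
  | apply: eff_query | apply: eff_pred | apply: eff_sub | apply: eff_eq
  | apply: eff_leq | apply: eff_and | apply: eff_not | apply: eff_ifb
  | apply: eff_if ].

(** Forgetting the oracle by answering all queries with 0 turns a program that
    ignores its oracle into an oracle-free one. *)
Fixpoint erase (c : prog) : prog :=
  match c with
  | Query => Zero
  | Pair c1 c2 => Pair (erase c1) (erase c2)
  | Comp c1 c2 => Comp (erase c1) (erase c2)
  | PRec b s => PRec (erase b) (erase s)
  | Mu f => Mu (erase f)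
  | _ => c
  end.

Lemma oracle_free_erase c : oracle_free (erase c).
Proof. by elim: c => //= c -> d ->. Qed.

Lemma eval_erase g c : eval g (erase c) = eval (fun=> 0) c.
Proof. by elim: c => //= [c -> d ->|c -> d ->|c -> d ->|c ->]. Qed.

(** Computability of a set thus becomes a special case of effectiveness, and
    oracle-free programs need no further consideration. *)
Lemma computableE X : computable X <-> effective (fun=> chi X).
Proof.
split=> [[c _ hc]|[c hc]]; first by exists c.
by exists (erase c) => [|g n]; rewrite ?oracle_free_erase ?eval_erase.
Qed.

Lemma chiE (X : set nat) (b : nat -> bool) :
  (forall x, X x <-> b x) -> chi X = b :> (nat -> nat).
Proof.
move=> Xb; apply/funext => x; rewrite /chi; congr nat_of_bool.
by apply/idP/idP => [/set_mem /Xb|/Xb /mem_set].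
Qed.

(** * Deciding which numbers code programs *)

Definition code_test (k T : nat) : bool :=
  let t := unpair1 k in let d := unpair2 k in
  let lookup j := coord (k - j.+1) T in
  if t <= 4 then d == 0
  else if t <= 7 then (lookup (unpair1 d) == 1) && (lookup (unpair2 d) == 1)
  else (t == 8) && (lookup d == 1).

(** Course-of-values recursion: the table at n lists the answers for n-1, ..., 0,
    in this order, as new entries are put in front. *)
Fixpoint code_table n :=
  if n is k.+1 then pairing (code_test k (code_table k)) (code_table k) else 0.

Definition is_code n := code_test n (code_table n).

Lemma code_table_lookup j k : j < k -> coord (k - j.+1) (code_table k) = is_code j.
Proof.
elim: k => // k IHk; rewrite ltnS leq_eqVlt => /predU1P[->|lt_jk].
  by rewrite subnn coord0 /= pairingK.
by rewrite subSn // coordS /= pairingK IHk.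
Qed.

Lemma is_codeP n : reflect (exists c, godel c = n) (is_code n).
Proof.
have ltd t d : 0 < t -> d < pairing t d by apply: ltn_pairing2.
have lt1 t a b : 0 < t -> a < pairing t (pairing a b).
  by move=> /(@ltd _ (pairing a b)); apply: leq_ltn_trans; apply: leq_pairing1.
have lt2 t a b : 0 < t -> b < pairing t (pairing a b).
  by move=> /(@ltd _ (pairing a b)); apply: leq_ltn_trans; apply: leq_pairing2.
have one (b : bool) : (b == 1 :> nat) = b by case: b.
(* The components of a code are smaller, so the table answers for them. *)
apply: (iffP idP) => [|[c <-{n}]]; last first.
  elim: c => [|||||c IHc d IHd|c IHc d IHd|c IHc d IHd|c IHc] /=;
    rewrite /is_code /code_test !pairingK //= !code_table_lookup ?one ?IHc ?IHd //;
    by [apply: lt1 | apply: lt2 | apply: ltd].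
elim/ltn_ind: n => n; rewrite -(unpairK n).
move: (unpair1 n) (unpair2 n) => t d {n}.
rewrite /is_code /code_test !pairingK -(unpairK d).
move: (unpair1 d) (unpair2 d) => a b {d} IHn.
case: t IHn => [|[|[|[|[|[|[|[|[|t]]]]]]]]] IHn //=; rewrite ?code_table_lookup ?pairingK ?one;
  try by [apply: lt1 | apply: lt2 | apply: ltd].
- by move=> /eqP ->; exists Zero.
- by move=> /eqP ->; exists Succ.
- by move=> /eqP ->; exists Fst.
- by move=> /eqP ->; exists Snd.
- by move=> /eqP ->; exists Query.
- move=> /andP[/IHn[|c <-]] //; first exact: lt1.
  move=> /IHn[|d <-] //; first exact: lt2.
  by exists (Pair c d).
- move=> /andP[/IHn[|c <-]] //; first exact: lt1.
  move=> /IHn[|d <-] //; first exact: lt2.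
  by exists (Comp c d).
- move=> /andP[/IHn[|c <-]] //; first exact: lt1.
  move=> /IHn[|d <-] //; first exact: lt2.
  by exists (PRec c d).
- by move=> /IHn[|c <-] //; [exact: ltd | exists (Mu c)].
Qed.

Lemma eff_is_code F : effective F -> effective (fun g x => is_code (F g x)).
Proof.
move=> hF; have hT : effective (fun g x => code_table (F g x)).
  by apply: (@eff_rec (fun _ _ n => code_table n) (fun _ _ => 0)
    (fun _ _ k T => pairing (code_test k T) T) (fun _ x => x)); rewrite /code_test; effective.
by rewrite /is_code /code_test; cbv zeta; effective.
Qed.

(** * A stack machine for programs *)

(** The pending tasks of an evaluation, each of which maps the current value to a
    new one: [Cons y] pairs with y, and [Search f a k] receives the value of f at
    <a, k>, during an unbounded search that has got as far as k. *)
Inductive frame := Run of prog | Then of prog & nat | Cons of nat | Search of prog & nat & nat.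

Definition state := (seq frame * nat)%type.

Definition step (g : nat -> nat) (st : state) : state :=
  let: (K0, v) := st in
  if K0 isn't f :: K then st else
  match f with
  | Run Zero => (K, 0)
  | Run Succ => (K, v.+1)
  | Run Fst => (K, unpair1 v)
  | Run Snd => (K, unpair2 v)
  | Run Query => (K, g v)
  | Run (Pair c d) => (Run c :: Then d v :: K, v)
  | Run (Comp c d) => (Run d :: Run c :: K, v)
  (* From the value z at <a, n>, the next two tasks build the argument <a, <n, z>>
     on which s runs. *)
  | Run (PRec b s) =>
      if unpair2 v is n.+1 then
        ([:: Run (PRec b s), Cons n, Cons (unpair1 v), Run s & K], pairing (unpair1 v) n)
      else (Run b :: K, unpair1 v)
  | Run (Mu f) => (Run f :: Search f v 0 :: K, pairing v 0)
  | Then d x => (Run d :: Cons v :: K, x)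
  | Cons y => (K, pairing y v)
  | Search f a k =>
      if v == 0 then (K, k) else (Run f :: Search f a k.+1 :: K, pairing a k.+1)
  end.

Definition reaches g (st st' : state) := exists n, iter n (step g) st = st'.

Lemma reaches_trans g st1 st2 st3 :
  reaches g st1 st2 -> reaches g st2 st3 -> reaches g st1 st3.
Proof. by move=> [m <-] [n <-]; exists (n + m); rewrite iterD. Qed.

Lemma reaches_step g st st' : reaches g (step g st) st' -> reaches g st st'.
Proof. by apply: reaches_trans; exists 1. Qed.

Lemma eval_PRecS g b s a n y :
  eval g (PRec b s) (pairing a n.+1) y <->
  exists2 z, eval g (PRec b s) (pairing a n) z & eval g s (pairing a (pairing n z)) y.
Proof. by rewrite /= !pairingK. Qed.

Lemma eval_PRec0 g b s a y : eval g (PRec b s) (pairing a 0) y <-> eval g b a y.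
Proof. by rewrite /= !pairingK. Qed.

(** The rest K of the stack is never inspected during the evaluation of a program,
    which is what makes the induction on the program go through. *)
Lemma eval_reaches g c x y K : eval g c x y -> reaches g (Run c :: K, x) (K, y).
Proof.
elim: c x y K => [|||||c IHc d IHd|c IHc d IHd|b IHb s IHs|f IHf] x y K.
1-5: by move=> /= ->; exists 1.
- move=> [y1 [y2 [/IHc h1 /IHd h2 ->]]]; apply: reaches_step.
  apply: reaches_trans (h1 _) _; apply: reaches_step.
  by apply: reaches_trans (h2 _) _; exists 1.
- move=> [z /IHd hd /IHc hc]; apply: reaches_step.
  by apply: reaches_trans (hd _) (hc _).
- rewrite -(unpairK x); move: (unpair1 x) (unpair2 x) => a n {x}.
  elim: n y K => [|n IHn] y K.
    move=> /eval_PRec0/IHb hb; apply: reaches_step => /=; rewrite !pairingK.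
    exact: hb.
  move=> /eval_PRecS[z /IHn hz /IHs hy]; apply: reaches_step => /=; rewrite !pairingK.
  apply: reaches_trans (hz _) _.
  by do 2!apply: reaches_step => /=; apply: hy.
- move=> [hy lt_y]; apply: reaches_step => /=.
  (* Induct on the distance i from the current candidate k to the least zero y. *)
  suff: forall i k, k + i = y -> reaches g (Run f :: Search f x k :: K, pairing x k) (K, y).
    by apply; rewrite add0n.
  elim=> [|i IHi] k def_y.
    rewrite addn0 in def_y; subst k.
    by apply: reaches_trans (IHf _ _ _ hy) _; exists 1.
  have [v hv] : exists v, eval g f (pairing x k) v.+1.
    by apply: lt_y; rewrite -def_y -addSnnS leq_addr.
  apply: reaches_trans (IHf _ _ _ hv) _; apply: reaches_step => /=.
  by apply: IHi; rewrite addSnnS.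
Qed.

(** The relation between the value that a task receives and the one it returns. At
    [Search f a k] the candidates below k have been refuted, so that only those
    from k on matter. *)
Definition frame_sem g (f : frame) (v y : nat) : Prop :=
  match f with
  | Run c => eval g c v y
  | Then d x => exists2 z, eval g d x z & y = pairing v z
  | Cons x => y = pairing x v
  | Search f a k =>
      v = 0 /\ y = k \/
      [/\ 0 < v, k < y, eval g f (pairing a y) 0 &
        forall j, k < j < y -> exists u, eval g f (pairing a j) u.+1]
  end.

Fixpoint stack_sem g K v y :=
  if K is f :: K' then exists2 z, frame_sem g f v z & stack_sem g K' z y else y = v.

(** Soundness of the machine. Going backwards one step at a time from an empty
    stack, where the meaning is trivial, yields a value for the initial state;
    no analysis of whole runs is needed. *)
Lemma stack_sem_step g K v y :
  stack_sem g (step g (K, v)).1 (step g (K, v)).2 y -> stack_sem g K v y.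
Proof.
case: K => [//|[c|d x|x|f a k] K] /=.
- case: c => [|||||c d|c d|b s|f] /=; try by move=> h; eexists; last exact: h.
  + move=> [y1 h1 [z [y2 h2 ->] hz]].
    by exists (pairing y1 y2) => //; exists y1, y2.
  + by move=> [z hz [w hw hy]]; exists w => //; exists z.
  + rewrite -(unpairK v); move: (unpair1 v) (unpair2 v) => a [|n]; rewrite !pairingK /=.
      by move=> [z hz hy]; exists z.
    rewrite !pairingK; move=> [z hz [_ -> [_ -> [w hw hy]]]].
    by exists w => //; exists z.
  + move=> [u hu [z sem_z hy]].
    case: sem_z hu hy => [[-> ->] hu hy|[u_gt0 z_gt0 hz ltz] hu hy]; first by exists 0.
    exists z => //; split=> // -[_|j lt_j]; last exact: ltz.
    by exists u.-1; rewrite prednK.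
- by move=> [z hz [_ -> hy]]; exists (pairing v z) => //; exists z.
- by move=> hy; exists (pairing x v).
- case: eqP => [->|/eqP v_neq0] /=; first by exists k => //; left.
  move=> [u hu [z sem_z hy]]; exists z => //; right; rewrite lt0n.
  case: sem_z hu => [[-> ->] hu|[u_gt0 lt_z hz ltz] hu].
    by split=> // j; rewrite ltnS; case: ltngtP.
  split=> //; first exact: ltnW.
  move=> j /andP[]; rewrite leq_eqVlt => /predU1P[<- _|lt_j lt_jz].
    by exists u.-1; rewrite prednK.
  by apply: ltz; rewrite lt_j.
Qed.

Lemma halts_reaches g c x :
  (exists y, eval g c x y) <-> exists n, (iter n (step g) ([:: Run c], x)).1 = [::].
Proof.
split=> [[y /eval_reaches-/(_ [::])[n hn]]|[n hn]]; first by exists n; rewrite hn.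
have {hn} : exists y, stack_sem g (iter n (step g) ([:: Run c], x)).1
                                 (iter n (step g) ([:: Run c], x)).2 y.
  by eexists; rewrite hn.
elim: n => [|n IHn] /=; first by move=> [_ [y hy _]]; exists y.
move: IHn; case: (iter n _ _) => K v IHn [y hy]; apply: IHn.
by exists y; apply: stack_sem_step.
Qed.

(** * The machine on numbers *)

Definition code_frame (f : frame) : nat :=
  match f with
  | Run c => godel c
  | Then c x => pairing 9 (pairing (godel c) x)
  | Cons y => pairing 10 y
  | Search f a k => pairing 11 (pairing (godel f) (pairing a k))
  end.

Fixpoint code_stack K :=
  if K is f :: K' then (pairing (code_frame f) (code_stack K')).+1 else 0.

Definition code_state (st : state) := pairing (code_stack st.1) st.2.

Definition push f K := (pairing f K).+1.

(** The tags 0 to 8 are those of [godel], so that the code of a program serves as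
    the code of the task of running it; 9, 10 and 11 mark the other tasks. *)
Definition code_step (g : nat -> nat) (s : nat) : nat :=
  let v := unpair2 s in
  let f := unpair1 (unpair1 s).-1 in
  let K := unpair2 (unpair1 s).-1 in
  let t := unpair1 f in
  let d := unpair2 f in
  if unpair1 s == 0 then s
  else if t == 0 then pairing K 0
  else if t == 1 then pairing K v.+1
  else if t == 2 then pairing K (unpair1 v)
  else if t == 3 then pairing K (unpair2 v)
  else if t == 4 then pairing K (g v)
  else if t == 5 then
    pairing (push (unpair1 d) (push (pairing 9 (pairing (unpair2 d) v)) K)) v
  else if t == 6 then pairing (push (unpair2 d) (push (unpair1 d) K)) v
  else if t == 7 then
    if unpair2 v == 0 then pairing (push (unpair1 d) K) (unpair1 v)
    else pairing
      (push f (push (pairing 10 (unpair2 v).-1)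
        (push (pairing 10 (unpair1 v)) (push (unpair2 d) K))))
      (pairing (unpair1 v) (unpair2 v).-1)
  else if t == 8 then
    pairing (push d (push (pairing 11 (pairing d (pairing v 0))) K)) (pairing v 0)
  else if t == 9 then pairing (push (unpair1 d) (push (pairing 10 v) K)) (unpair2 d)
  else if t == 10 then pairing K (pairing d v)
  else let a := unpair1 (unpair2 d) in let k := unpair2 (unpair2 d) in
    if v == 0 then pairing K k
    else pairing
      (push (unpair1 d) (push (pairing 11 (pairing (unpair1 d) (pairing a k.+1))) K))
      (pairing a k.+1).

Lemma eff_code_step : effective code_step.
Proof. by rewrite /code_step /push; cbv zeta; effective. Qed.

Lemma code_stepE g st : code_step g (code_state st) = code_state (step g st).
Proof.
rewrite /code_step /code_state; case: st => [[|f K] v]; rewrite !pairingK //=.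
case: f => [[|||||c d|c d|b s|f]|d x|x|f a k] /=; rewrite ?pairingK //=.
- by case: (unpair2 v).
- by case: eqP.
Qed.

(** * Approximating the jump *)

(** Stage n of the enumeration of the jump. The test for codes is needed since
    numbers that code no program are executed as well. *)
Definition jump_stage (g : nat -> nat) (e n : nat) : bool :=
  is_code e && (unpair1 (iter n (code_step g) (pairing (push e 0) e)) == 0).

Lemma eff_jump_stage E N : effective E -> effective N ->
  effective (fun g x => jump_stage g (E g x) (N g x)).
Proof.
move=> hE hN; apply: eff_and; first exact: eff_is_code.
apply: eff_eq; last exact: eff_const; apply: eff_fst.
by apply: eff_iter => //; [exact: eff_code_step | rewrite /push; effective].
Qed.

Lemma iter_code_step g n st :
  iter n (code_step g) (code_state st) = code_state (iter n (step g) st).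
Proof. by elim: n => //= n ->; rewrite code_stepE. Qed.

Lemma jump_stage_godel g c n :
  jump_stage g (godel c) n = nilp (iter n (step g) ([:: Run c], godel c)).1.
Proof.
have -> : jump_stage g (godel c) n =
    (unpair1 (code_state (iter n (step g) ([:: Run c], godel c))) == 0).
  rewrite -iter_code_step /jump_stage; suff -> : is_code (godel c) by [].
  by apply/is_codeP; exists c.
by rewrite /code_state pairingK; case: (_.1).
Qed.

Lemma jump_stage_mono g e m n : m <= n -> jump_stage g e m -> jump_stage g e n.
Proof.
move=> /subnK <-; elim: (n - m) => // k IHk /IHk.
have [[c <-]|not_code] := is_codeP e; last by rewrite /jump_stage; case: is_codeP.
by rewrite !jump_stage_godel addSn /=; case: (iter _ _ _) => [[|f K] v].
Qed.

Lemma jumpP Z e : jump Z e <-> exists n, jump_stage (chi Z) e n.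
Proof.
split=> [[c <- /halts_reaches[n hn]]|[n he]].
  by exists n; rewrite jump_stage_godel hn.
have [c def_e] : exists c, godel c = e by move: he => /andP[/is_codeP].
move: he; rewrite -def_e jump_stage_godel => /nilP he.
by exists c => //; apply/halts_reaches; exists n.
Qed.

Lemma jump_stage_lim Z e :
  exists m, forall n, m <= n -> jump_stage (chi Z) e n = (e \in jump Z).
Proof.
have [Ze|Ze] := boolP (e \in jump Z).
  have [m hm] := (jumpP Z e).1 (set_mem Ze).
  by exists m => n /jump_stage_mono; apply.
exists 0 => n _; apply/negbTE; apply: contra Ze => hn.
by apply/mem_set/jumpP; exists n.
Qed.

(** * Unbounded quantifiers and limits below the halting problem *)

Lemma eval_Mu_total g c F a : (forall p, eval g c p (F p)) ->
    (exists k, F (pairing a k) = 0) ->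
  exists k, eval g (Mu c) a k /\ F (pairing a k) = 0.
Proof.
move=> hc [k0 Fk0]; have exF : exists k, F (pairing a k) == 0 by exists k0; apply/eqP.
case: (ex_minnP exF) => k /eqP Fk min_k; exists k; split=> //; split.
  by rewrite -Fk.
move=> j lt_jk; exists (F (pairing a j)).-1; rewrite prednK // lt0n.
by apply: contraL lt_jk => /min_k; rewrite -leqNgt.
Qed.

Fixpoint const_prog n := if n is m.+1 then Comp Succ (const_prog m) else Zero.

Lemma eval_const_prog g n x y : eval g (const_prog n) x y <-> y = n.
Proof.
by elim: n y => //= n IHn y; split=> [[z /IHn -> //]|->]; exists n => //; apply/IHn.
Qed.

(** A search that ignores its input, with its parameter q built in as a constant:
    the code of this program is in the jump if and only if the search succeeds, and
    the code is primitive recursive in q. *)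
Lemma exists_le_jump (P : nat -> nat -> bool) :
    effective (fun _ p => P (unpair1 p) (unpair2 p)) ->
  exists2 e : nat -> nat, effective (fun=> e) &
    forall Y q, jump Y (e q) <-> exists x, P q x.
Proof.
move=> hP; have [c hc] := eff_not hP.
exists (fun q => godel (Comp (Mu c) (const_prog q))).
  have hK : effective (fun _ x => godel (const_prog x)).
    apply: (@eff_rec (fun _ _ n => godel (const_prog n)) (fun _ _ => godel Zero)
      (fun _ _ _ z => pairing 6 (pairing (godel Succ) z)) (fun _ x => x)) => //; effective.
  by apply: eff_pair; effective.
move=> Y q; split.
  move=> [d /godel_inj -> [y [_ /eval_const_prog -> [hy _]]]]; exists y.
  by have := eval_det hy (hc _ _); rewrite !pairingK; case: (P q y).
move=> [x Px]; exists (Comp (Mu c) (const_prog q)) => //.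
have [|k [hk _]] := @eval_Mu_total (chi Y) c _ q (hc _).
  by exists x; rewrite !pairingK Px.
by exists k; exists q => //; apply/eval_const_prog.
Qed.

Lemma infinite_natP (A : set nat) : infinite_set A <-> forall m, exists2 x, m <= x & A x.
Proof.
split=> [infA m|unbA /finite_seqP[s defA]].
  apply: contrapT => noA; apply: infA; apply: sub_finite_set (finite_II m) => x Ax /=.
  by rewrite ltnNge; apply/negP => le_mx; apply: noA; exists x.
have [x lt_x] := unbA (\max_(y <- s) y).+1; rewrite defA /= => s_x.
by move: lt_x; rewrite ltnNge (@leq_bigmax_seq _ _ _ (fun y => y)).
Qed.

Lemma finite_natP (A : set nat) : finite_set A <-> exists m, forall x, A x -> x < m.
Proof.
split=> [finA|[m ltm]]; last exact: sub_finite_set ltm (finite_II m).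
apply: contrapT => unbA; suff: infinite_set A by [].
apply/infinite_natP => m; apply: contrapT => noA; apply: unbA; exists m => x Ax.
by rewrite ltnNge; apply/negP => le_mx; apply: noA; exists x.
Qed.

(** The limit lemma, along a computable set. To compute X(i), search for a pair
    <m, b> such that no x >= m in R has f(i, x) <> b; the halting problem decides
    this property of the pair, and b must be the limit since R is infinite. *)
Lemma limit_turing_le (R X : set nat) (f : nat -> nat -> nat) :
    computable R -> infinite_set R ->
    effective (fun _ p => f (unpair1 p) (unpair2 p)) ->
    (forall i, exists m, forall x, m <= x -> R x -> f i x = chi X i) ->
  turing_le X (jump set0).
Proof.
move=> /computableE hR /infinite_natP infR hf limf.
pose P q x := [&& unpair1 (unpair2 q) <= x, x \in R
  & f (unpair1 q) x != unpair2 (unpair2 q)].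
have [e he jumpe] : exists2 e : nat -> nat, effective (fun=> e) &
    forall Y q, jump Y (e q) <-> exists x, P q x.
  have hRx : effective (fun _ p => unpair2 p \in R).
    by apply: (eff_comp hR); effective.
  have hfx : effective (fun _ p => f (unpair1 (unpair1 p)) (unpair2 p)).
    by apply: (@eff_bin (fun=> f) _ _ hf); effective.
  by apply: exists_le_jump; rewrite /P; effective.
have [c hc] := eff_query he.
exists (Comp Snd (Mu c)) => i.
have [m0 lim_m0] := limf i.
have [|k [hk ek0]] := @eval_Mu_total (chi (jump set0)) c _ i (hc _).
  (* The search succeeds: from m0 on, f has reached its limit. *)
  exists (pairing m0 (chi X i)); rewrite /chi; case: (boolP (_ \in jump set0)) => //.
  move=> /set_mem/jumpe[x]; rewrite /P !pairingK => /and3P[le_x /set_mem Rx].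
  by rewrite lim_m0 ?eqxx.
exists k => //=.
have [x le_x Rx] := infR (maxn m0 (unpair1 k)).
(* An x in R beyond both bounds shows that the pair found has the limit as its
   second component. *)
move: le_x; rewrite geq_max => /andP[le_m0x le_kx].
rewrite -(lim_m0 x) //; apply/eqP; apply: contraPT ek0 => neq.
rewrite /chi mem_set //; apply/jumpe; exists x.
by rewrite /P !pairingK le_kx mem_set.
Qed.

(** * The tower *)

Fixpoint follows g n x : bool :=
  if n is k.+1 then follows g k x && (coord k x == jump_stage g k x) else true.

Definition tower Z : set nat := [set p | follows (chi Z) (unpair2 p) (unpair1 p)].

Lemma column_tower Z n : column (tower Z) n = [set x | follows (chi Z) n x].
Proof. by rewrite /column /tower /=; apply/funext => x /=; rewrite !pairingK. Qed.

Lemma eff_follows : effective (fun g p => follows g (unpair2 p) (unpair1 p)).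
Proof.
have hJ : effective (fun g p => jump_stage g (unpair1 (unpair2 p)) (unpair1 p)).
  by apply: eff_jump_stage; effective.
apply: (@eff_rec (fun g x n => follows g n x) (fun _ _ => 1) (fun g x k z =>
  (z == 1) && (coord k x == jump_stage g k x))) => //; effective.
by move=> g x n /=; case: (follows g n x).
Qed.

(** Finitely many values can be hard-wired. This makes each column of the tower
    computable, though together the columns are computable only from Z. *)
Lemma eff_eventually_const m b (f : nat -> nat) :
  (forall x, m <= x -> f x = b) -> effective (fun=> f).
Proof.
elim: m f => [|m IHm] f fb.
  by apply: eff_ext (eff_const b) => _ x; rewrite fb.
have hf : effective (fun _ x => if x == m then b else f x).
  apply: IHm => x; rewrite leq_eqVlt eq_sym; case: eqP => //= _; exact: fb.
have := eff_if (eff_eq eff_arg (eff_const m)) (eff_const (f m)) hf.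
by apply: eff_ext => _ x; case: eqP => [->|].
Qed.

(** For a fixed n, the column refers to the enumeration of Z' only through n
    eventually constant functions of the stage. *)
Lemma computable_column_tower Z n : computable (column (tower Z) n).
Proof.
rewrite column_tower; apply/computableE; rewrite (@chiE _ (follows (chi Z) n)) //.
elim: n => [|n IHn] /=; first exact: eff_const.
have [m lim_m] := jump_stage_lim Z n.
have hJ : effective (fun _ x => jump_stage (chi Z) n x).
  by apply: (@eff_eventually_const m (n \in jump Z)) => x /lim_m ->.
by effective.
Qed.

Lemma follows_lim Z n : exists m, forall x, m <= x ->
  follows (chi Z) n x <-> forall i, i < n -> coord i x = chi (jump Z) i.
Proof.
elim: n => [|n [m hm]]; first by exists 0.
have [m' hm'] := jump_stage_lim Z n.
exists (maxn m m') => x; rewrite geq_max => /andP[/hm {}hm /hm' {}hm'] /=.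
rewrite hm' -/(chi (jump Z) n); split.
  move=> /andP[/hm lt_n /eqP eq_n] i; rewrite ltnS leq_eqVlt => /predU1P[->|] //.
  exact: lt_n.
by move=> eq_i; rewrite eq_i // eqxx andbT; apply/hm => i lt_i; apply/eq_i/ltnW.
Qed.

(** Pairing is at least its second argument, so the free tail m makes x large. *)
Lemma exists_coord (a : nat -> nat) n b m :
  exists2 x, m <= x & (forall i, i < n -> coord i x = a i) /\ coord n x = b.
Proof.
elim: n a => [|n IHn] a.
  by exists (pairing b m); rewrite ?leq_pairing2 // coord0 pairingK.
have [x le_x [ax bx]] := IHn (fun i => a i.+1).
exists (pairing (a 0) x); first exact: leq_trans (leq_pairing2 _ _).
by split=> [[|i]|]; rewrite ?coord0 ?coordS pairingK //; apply: ax.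
Qed.

Lemma computable_tower_tower Z : computable_tower (tower Z).
Proof.
split=> [n||n]; first exact: computable_column_tower.
  by rewrite column_tower; apply/funext => x; apply/propext.
rewrite !column_tower; split.
  by apply/finite_natP; exists 0 => x /= [/andP[]].
apply/infinite_natP => m; have [m' lim_m'] := follows_lim Z n.
(* An entry equal to 2 can never be equal to a value of Z'_x. *)
have [x le_x [eq_x x2]] := exists_coord (chi (jump Z)) n 2 (maxn m m').
move: le_x; rewrite geq_max => /andP[le_mx /lim_m' lim_x].
exists x => //=; split; first exact/lim_x.
by rewrite x2; case: jump_stage; rewrite andbF.
Qed.

Lemma maximal_tower_tower Z : NonLow Z -> maximal_tower (tower Z).
Proof.
move=> nonlowZ; split=> [|R compR infR]; first exact: computable_tower_tower.
apply: contrapT => finR; apply: nonlowZ.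
apply: (limit_turing_le (R := R) (f := coord)) => // [|i].
  by apply: eff_coord; effective.
have [m hm] : exists m, forall x, (R `\` column (tower Z) i.+1) x -> x < m.
  by apply/finite_natP; apply: contrapT => infRi; apply: finR; exists i.+1.
have [m' lim_m'] := follows_lim Z i.+1.
exists (maxn m m') => x; rewrite geq_max => /andP[le_mx /lim_m' lim_x] Rx.
apply: lim_x.1 (ltnSn i); apply: contrapT => not_x.
by move: le_mx; rewrite leqNgt hm // column_tower.
Qed.

Theorem theorem3p1 : medvedev_le (chi @` MaxTowers) (chi @` NonLow).
Proof.
have [c hc] := eff_follows; exists c => _ [Z nonlowZ <-].
exists (chi (tower Z)); first by exists (tower Z) => //; apply: maximal_tower_tower.
move=> n.
by rewrite (@chiE (tower Z) (fun p => follows (chi Z) (unpair2 p) (unpair1 p))).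
Qed.
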